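(* There is an absolute constant $C>0$ such that the following holds. Let $p\in\mathbb{N}$ and let $G=(V,E,w)$ be a connected $p$-path-separable graph with non-negative edge weights and $|V|\ge 2$. Then $G$ is $\beta$-decomposable with $\beta = C\cdot\max\{1,\ln(p\ln|V|)\}$. (In the paper's notation: every $p$-path-separable graph $(V,E,w)$ is $O(\ln(p\ln|V|))$-decomposable.)
   Context: For a connected graph $G=(V,E,w)$ with non-negative edge weights, $d_G$ denotes the shortest-path metric on $V$ induced by $w$, and $B_G(u,\varrho)=\{v\in V: d_G(u,v)\le\varrho\}$. For a partition $\Pi$ of $V$ and $x\in V$, $\Pi(x)$ denotes the part of $\Pi$ containing $x$; $\mathrm{diam}(S)=\max_{x,y\in S}d_G(x,y)$. $\beta$-decomposable: for $\beta>0$, $G$ (i.e. the metric space $(V,d_G)$) is $\beta$-decomposable if for every $\Delta>0$ there is a probability distribution $\mu$ over partitions of $V$ such that (a) for every $\Pi$ in the support of $\mu$ and every $S\in\Pi$, $\mathrm{diam}(S)\le\Delta$; and (b) for every $x\in V$ and every $0\le\gamma\le 1/100$, $\Pr_{\Pi\sim\mu}[B_G(x,\gamma\Delta)\subseteq\Pi(x)]\ge 2^{-\beta\gamma}$. Separators: for $S\subseteq V$, an $S$-flap is a connected component of the induced subgraph $G[V\setminus S]$ (with the inherited edge weights). $S$ is a (balanced) vertex separator if every $S$-flap has at most $|V|/2$ vertices. For sets $X_1,\dots,X_m$ and $J\subseteq[m]$, $X_J=\bigcup_{j\in J}X_j$. $p$-path-separable (defined recursively): a graph $G=(V,E,w)$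 is $p$-path-separable ($p\in\mathbb{N}$) if there is $S\subset V$ such that: (1) there exist $P_1,\dots,P_m\subseteq V$ with $S=P_{[m]}$, where each $P_j$ is the union of $p_j$ shortest paths in the graph $G_j = G\setminus P_{[j-1]}$ (shortest with respect to $G_j$'s own weighted shortest-path distances); (2) $\sum_{j\in[m]}p_j\le p$; (3) $S$ is a balanced vertex separator of $G$, and every $S$-flap is $p$-path-separable. *)

(* Defs.v *)
From HB Require Import structures.
From mathcomp Require Import all_boot all_order all_algebra.
From mathcomp Require Import all_classical all_reals all_analysis.

Set Implicit Arguments.
Unset Strict Implicit.
Unset Printing Implicit Defensive.

Import Order.TTheory GRing.Theory Num.Theory.

Local Open Scope ring_scope.

(* Values of [wt] on non-edges are irrelevant. *)
Record wgraph (R : realType) (V : finType) := WGraph {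
  edge : rel V;
  wt : V -> V -> R;
  edge_sym : symmetric edge;
  edge_irr : irreflexive edge;
  wt_sym : forall x y, edge x y -> wt x y = wt y x;
  wt_ge0 : forall x y, edge x y -> 0 <= wt x y
}.

Definition connected_graph (R : realType) (V : finType) (G : wgraph R V) : Prop :=
  forall x y : V, connect (edge G) x y.

(* All subgraphs that occur are induced ones: below, a vertex set [U : {set V}]
   stands for G[U], and [[set: V]] for G itself. *)
Definition induced (R : realType) (V : finType) (G : wgraph R V) (U : {set V}) :
    rel V :=
  [rel x y | [&& x \in U, y \in U & edge G x y]].

Definition components (R : realType) (V : finType) (G : wgraph R V)
    (U : {set V}) : {set {set V}} :=
  equivalence_partition (connect (induced G U)) U.

(* [x :: s] is a path of G[U] ending at [y]; vertices do not repeat, which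
   matters for shortest paths since edges may have weight 0. *)
Definition is_path (R : realType) (V : finType) (G : wgraph R V) (U : {set V})
    (x y : V) (s : seq V) : bool :=
  [&& x \in U, path (induced G U) x s, uniq (x :: s) & last x s == y].

Definition path_length (R : realType) (V : finType) (G : wgraph R V)
    (x : V) (s : seq V) : R :=
  \sum_(r <- pairmap (wt G) x s) r.

(* Shortest-path distance of G[U]; it is +oo between different components. *)
Definition dist (R : realType) (V : finType) (G : wgraph R V) (U : {set V})
    (x y : V) : \bar R :=
  ereal_inf [set (path_length G x s)%:E | s in [set s | is_path G U x y s]]%classic.

Definition shortest_path (R : realType) (V : finType) (G : wgraph R V)
    (U : {set V}) (q : seq V) : Prop :=
  exists x s, [/\ q = x :: s, is_path G U x (last x s) s
    & (path_length G x s)%:E = dist G U x (last x s)].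

Definition union_of_shortest_paths (R : realType) (V : finType) (G : wgraph R V)
    (U : {set V}) (k : nat) (X : {set V}) : Prop :=
  exists Q : 'I_k -> seq V,
    (forall i, shortest_path G U (Q i)) /\ X = \bigcup_(i < k) [set x in Q i].

Definition flaps (R : realType) (V : finType) (G : wgraph R V)
    (U S : {set V}) : {set {set V}} :=
  components G (U :\: S).

Definition balanced_separator (R : realType) (V : finType) (G : wgraph R V)
    (U S : {set V}) : Prop :=
  forall F, F \in flaps G U S -> (2 * #|F| <= #|U|)%N.

(* [S = U] is allowed: a one-vertex graph has no other balanced separator, so
   the recursion would otherwise have no base case. *)
Inductive path_separable (R : realType) (V : finType) (G : wgraph R V) (p : nat) :
    {set V} -> Prop :=
  PathSeparable (U S : {set V}) (m : nat) (P : 'I_m -> {set V})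
      (k : 'I_m -> nat) of
    S \subset U
  & S = \bigcup_(j < m) P j
  & (forall j : 'I_m,
       union_of_shortest_paths G (U :\: \bigcup_(i < m | (i < j)%N) P i)
                               (k j) (P j))
  & (\sum_(j < m) k j <= p)%N
  & balanced_separator G U S
  & (forall F, F \in flaps G U S -> path_separable G p F)
  : path_separable G p U.

Definition ball_set (R : realType) (V : finType) (G : wgraph R V)
    (x : V) (r : R) : {set V} :=
  [set v | (dist G [set: V] x v <= r%:E)%E].

Definition diam (R : realType) (V : finType) (G : wgraph R V) (S : {set V}) :
    \bar R :=
  \big[Order.max/0%E]_(x in S) \big[Order.max/0%E]_(y in S) dist G [set: V] x y.

(* A probability distribution over partitions of the finite set V is given by
   its mass function, supported on the partitions among all sets of sets. *)
Definition partition_distribution (R : realType) (V : finType)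
    (mu : {ffun {set {set V}} -> R}) : Prop :=
  [/\ forall Pi, 0 <= mu Pi, \sum_Pi mu Pi = 1
    & forall Pi, mu Pi != 0 -> finset.partition Pi [set: V]].

Definition prob (R : realType) (V : finType) (mu : {ffun {set {set V}} -> R})
    (A : pred {set {set V}}) : R :=
  \sum_(Pi | A Pi) mu Pi.

Definition decomposable (R : realType) (V : finType) (G : wgraph R V)
    (beta : R) : Prop :=
  0 < beta /\
  forall Delta : R, 0 < Delta ->
  exists mu : {ffun {set {set V}} -> R},
    [/\ partition_distribution mu,
        forall Pi, mu Pi != 0 ->
          forall S, S \in Pi -> (diam G S <= Delta%:E)%E
      & forall (x : V) (gamma : R), 0 <= gamma <= 1 / 100 ->
          2 `^ (- (beta * gamma)) <=
          prob mu (fun Pi => ball_set G x (gamma * Delta) \subset finset.pblock Pi x)].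

(* Main.v *)
(**
The clusters are carved one after another. Process the separator hierarchy from
the root; along every shortest path Q of the residual graph H put a net of
centres, one for each nonempty cell of length Delta/4, and let a centre t carve
the H-ball around t whose radius, between 0.27 Delta and Delta/2, is drawn from a
truncated exponential law of rate l = 100 mu / Delta, where
mu = max (1, ln (p ln n)).

Fix a ball B of radius gamma Delta.  Until the first path meeting B is reached, B
lies inside the residual graph of every centre that can touch it, so the distance
to such a centre varies by at most 2 gamma Delta on B.  Since each Q is a shortest
path, at most six of its centres come close enough to touch B; hence at most
M = 6 p (1 + log2 n) centres do, and a net point of the first path meeting B
swallows B for certain.  By memorylessness a touching centre swallows B with
conditional probability q = exp (- 2 gamma Delta l), up to the truncation defect
kappa ~ exp (- 23 mu), so B survives with probability at least
q - (1 - q) kappa M >= q^2.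
*)
From mathcomp Require Import all_boot all_order all_algebra.
From mathcomp Require Import all_classical all_reals all_analysis.
From mathcomp Require Import ring lra zify.
Require Import Defs.
Import Order.TTheory GRing.Theory Num.Theory.
Local Open Scope ring_scope.

Set Implicit Arguments.
Unset Strict Implicit.
Unset Printing Implicit Defensive.

(** * Shortest-path distances *)

Section Distances.
Variables (R : realType) (V : finType) (G : wgraph R V).
Implicit Types (U W H B : {set V}) (x y z t u v : V) (s : seq V).

Lemma path_length_cons x y s :
  path_length G x (y :: s) = wt G x y + path_length G y s.
Proof. by rewrite /path_length /= big_cons. Qed.

Lemma path_length_cat x s1 s2 :
  path_length G x (s1 ++ s2) = path_length G x s1 + path_length G (last x s1) s2.
Proof.
elim: s1 x => [|y s1 IH] x /=; first by rewrite /path_length big_nil add0r.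
by rewrite !path_length_cons IH addrA.
Qed.

Lemma induced_sym U : symmetric (induced G U).
Proof. by move=> x y; rewrite /induced /= (edge_sym G); case: (x \in U); case: (y \in U). Qed.

Lemma path_length_ge0 U x s : path (induced G U) x s -> 0 <= path_length G x s.
Proof.
elim: s x => [|y s IH] x /=; first by rewrite /path_length big_nil.
case/andP=> /and3P[_ _ exy] ps; rewrite path_length_cons.
by apply: addr_ge0; [exact: wt_ge0 | exact: IH].
Qed.

Lemma path_induced_all U x s : x \in U -> path (induced G U) x s ->
  {subset x :: s <= U}.
Proof.
elim: s x => [|y s IH] x xU /=; first by move=> _ z; rewrite inE => /eqP->.
case/andP=> /and3P[_ yU _] ps z; rewrite inE => /predU1P[->//|]; exact: IH.
Qed.

(** [is_path] forbids repeated vertices, but concatenation only yields walks. If the start reappears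
    in the shortened tail, the loop before it is dropped; weights being non-negative, this costs
    nothing. *)
Lemma walk_shorten U x s : path (induced G U) x s ->
  exists s', [/\ path (induced G U) x s', uniq (x :: s'), last x s' = last x s
    & path_length G x s' <= path_length G x s].
Proof.
elim: s x => [|y s IH] x; first by move=> _; exists [::]; split.
rewrite [path _ _ _]/= => /andP[exy /IH[s' [ps' us' ls' len']]].
have wxy : 0 <= wt G x y by case/and3P: exy => _ _; exact: wt_ge0.
have [xin|xnin] := boolP (x \in y :: s'); last first.
  exists (y :: s'); split=> //=; first by rewrite exy.
    by rewrite -cons_uniq /= xnin.
  by rewrite !path_length_cons lerD2l.
move: ps' us' ls' len'; case/splitPl: xin => p1 p2 lp1.
rewrite cat_path last_cat lp1 path_length_cat lp1 => /andP[pp1 pp2] us' ls' len'.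
exists p2; split=> //.
  have : subseq (x :: p2) (y :: p1 ++ p2).
    rewrite -cat_cons (lastI y p1) lp1 -cats1 -catA /=; exact: suffix_subseq.
  by move/subseq_uniq; apply.
rewrite path_length_cons; have := path_length_ge0 pp1; lra.
Qed.

Lemma dist_walk U x s : x \in U -> path (induced G U) x s ->
  (dist G U x (last x s) <= (path_length G x s)%:E)%E.
Proof.
move=> xU /walk_shorten[s' [ps' us' ls' len']].
apply: (@le_trans _ _ (path_length G x s')%:E); last by rewrite lee_fin.
apply: ereal_inf_lbound; exists s' => //=.
by rewrite /is_path xU ps' us' ls' eqxx.
Qed.

(** Repetition-free paths have bounded length, so there are finitely many and the infimum is a
    minimum. *)
Lemma dist_attained U x y : (dist G U x y < +oo)%E ->
  exists s, is_path G U x y s /\ dist G U x y = (path_length G x s)%:E.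
Proof.
move=> dfin.
have [[s0 Ps0]|none] := pselect (exists s, is_path G U x y s); last first.
  move: dfin; rewrite /dist (_ : image _ _ = set0) ?ereal_inf0 //.
  by apply/seteqP; split=> // r [s Ps _]; apply: none; exists s.
have szP s : is_path G U x y s -> (size s <= #|V|)%N.
  case/and4P=> _ _ us _; have := max_card (mem (x :: s)).
  by rewrite (card_uniqP us) => /ltnW.
pose b0 : #|V|.-bseq V := Bseq (szP _ Ps0).
have [b Pb minb] := @Order.TotalTheory.arg_minP _ _ _ b0
  (fun b : #|V|.-bseq V => is_path G U x y b) (fun b => path_length G x b) Ps0.
exists b; split=> //; apply/eqP; rewrite eq_le; apply/andP; split.
  by apply: ereal_inf_lbound; exists (b : seq V).
apply: le_ereal_inf_tmp => _ [s Ps <-]; rewrite lee_fin.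
exact: (minb (Bseq (szP _ Ps))).
Qed.

Lemma dist_ge0 U x y : (0 <= dist G U x y)%E.
Proof.
apply: le_ereal_inf_tmp => _ [s /and4P[_ ps _ _] <-]; rewrite lee_fin.
exact: path_length_ge0 ps.
Qed.

Lemma dist_fin_numE U x y : (dist G U x y < +oo)%E -> dist G U x y \is a fin_num.
Proof. by move=> d; rewrite ge0_fin_numE // dist_ge0. Qed.

Lemma dist_lt_mem U x y : (dist G U x y < +oo)%E -> x \in U /\ y \in U.
Proof.
case/dist_attained=> s [/and4P[xU ps _ /eqP<-] _]; split=> //.
exact: path_induced_all xU ps _ (mem_last _ _).
Qed.

Lemma dist_refl U x : x \in U -> dist G U x x = 0%E.
Proof.
move=> xU; apply/eqP; rewrite eq_le dist_ge0 andbT.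
by have := @dist_walk U x [::] xU isT; rewrite /path_length big_nil.
Qed.

Lemma dist_triangle U x y z : (dist G U x z <= dist G U x y + dist G U y z)%E.
Proof.
have [xy|] := ltP (dist G U x y) +oo%E; last first.
  rewrite leye_eq => /eqP->; rewrite addye ?leey //.
  by have := dist_ge0 U y z; case: dist.
have [yz|] := ltP (dist G U y z) +oo%E; last first.
  rewrite leye_eq => /eqP->; rewrite addey ?leey //.
  by have := dist_ge0 U x y; case: dist.
have [s1 [/and4P[xU ps1 _ /eqP ls1] ->]] := dist_attained xy.
have [s2 [/and4P[yU ps2 _ /eqP ls2] ->]] := dist_attained yz.
rewrite -EFinD -{1}ls1 -path_length_cat -ls2 -ls1 -last_cat; apply: dist_walk => //.
by rewrite cat_path ps1 ls1 ps2.
Qed.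

Lemma path_length_rev U x s : path (induced G U) x s ->
  path_length G (last x s) (rev (belast x s)) = path_length G x s.
Proof.
elim: s x => [|y s IH] x //= /andP[/and3P[_ _ exy] ps].
rewrite rev_cons -cats1 path_length_cat IH // path_length_cons addrC.
have -> : last (last y s) (rev (belast y s)) = y.
  by case: s {IH ps} => [|z s] //=; rewrite rev_cons last_rcons.
by rewrite path_length_cons /path_length big_nil addr0 (wt_sym exy).
Qed.

Lemma dist_le_rev U x y : (dist G U y x <= dist G U x y)%E.
Proof.
have [xy|] := ltP (dist G U x y) +oo%E; last first.
  by rewrite leye_eq => /eqP->; rewrite leey.
have [s [/and4P[xU ps _ /eqP ls] ->]] := dist_attained xy.
have yU : y \in U by rewrite -ls; exact: path_induced_all xU ps _ (mem_last _ _).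
have lrev : last (last x s) (rev (belast x s)) = x.
  by case: s {ps ls} => [|z s] //=; rewrite rev_cons last_rcons.
rewrite -(path_length_rev ps) ls -{1}lrev ls; apply: dist_walk => //.
rewrite -ls rev_path; apply: sub_path ps => a b /=.
by rewrite -(induced_sym U a b).
Qed.

Lemma dist_sym U x y : dist G U x y = dist G U y x.
Proof. by apply/eqP; rewrite eq_le !dist_le_rev. Qed.

Lemma dist_mono U W x y : U \subset W -> (dist G W x y <= dist G U x y)%E.
Proof.
move=> UW; have [xy|] := ltP (dist G U x y) +oo%E; last first.
  by rewrite leye_eq => /eqP->; rewrite leey.
have [s [/and4P[xU ps _ /eqP ls] ->]] := dist_attained xy.
rewrite -ls; apply: dist_walk; first exact: (fintype.subsetP UW).
apply: sub_path ps => a b /and3P[aU bU ab].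
by rewrite /induced /= !(fintype.subsetP UW).
Qed.

Lemma dist_connect U x y : (dist G U x y < +oo)%E -> connect (induced G U) x y.
Proof.
by case/dist_attained=> s [/and4P[xU ps _ /eqP ls] _]; apply/connectP; exists s.
Qed.

(** Prefixes of a shortest path from [x] are no longer than the whole, so the path never leaves the
    ball. The radius bound thus survives in every residual graph containing the ball. *)
Lemma ball_set_inner x y (r : R) : (dist G [set: V] x y <= r%:E)%E ->
  (dist G (ball_set G x r) x y <= r%:E)%E.
Proof.
move=> dr; have dfin : (dist G [set: V] x y < +oo)%E by apply: le_lt_trans dr (ltry _).
have [s [/and4P[_ ps _ /eqP ls] ds]] := dist_attained dfin.
have {ds} lr : path_length G x s <= r by rewrite -lee_fin -ds.
apply: (@le_trans _ _ (path_length G x s)%:E); last by rewrite lee_fin.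
have inB s1 s2 : s = s1 ++ s2 -> last x s1 \in ball_set G x r.
  move=> es; move: ps lr; rewrite es cat_path path_length_cat inE => /andP[ps1 ps2] lr.
  apply: le_trans (dist_walk _ ps1) _; first by rewrite inE.
  by rewrite lee_fin; have := path_length_ge0 ps2; lra.
rewrite -ls; apply: dist_walk; first exact: (inB [::] s).
suff H s1 s2 : s = s1 ++ s2 -> path (induced G (ball_set G x r)) (last x s1) s2.
  exact: (H [::] s).
elim: s2 s1 => [|a s2 IH] s1 es //=.
have es' : s = rcons s1 a ++ s2 by rewrite es cat_rcons.
have := IH _ es'; rewrite last_rcons => ->; rewrite andbT.
have := inB _ _ es'; rewrite last_rcons /induced /= (inB _ _ es) => ->.
by move: ps; rewrite es cat_path /= => /and3P[_ /and3P[_ _ ->] _].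
Qed.

(* Along a shortest path, distance to the origin is a parametrization by arc length. *)
Lemma shortest_path_dist U x s y z :
  is_path G U x (last x s) s ->
  (path_length G x s)%:E = dist G U x (last x s) ->
  y \in x :: s -> z \in x :: s ->
  [/\ (dist G U x y < +oo)%E, (dist G U x z < +oo)%E &
   (dist G U y z <= `|fine (dist G U x y) - fine (dist G U x z)|%:E)%E].
Proof.
case/and4P=> xU ps _ _ short.
(* A prefix of a shortest path is shortest: a shortcut to its end, followed by the rest, would beat
   the whole path. *)
have pre s1 s2 : s = s1 ++ s2 -> dist G U x (last x s1) = (path_length G x s1)%:E.
  move=> es; move: ps short; rewrite es cat_path path_length_cat last_cat => /andP[ps1 ps2] short.
  have d1 := dist_walk xU ps1.
  have l1U : last x s1 \in U by apply: path_induced_all xU ps1 _ (mem_last _ _).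
  have d2 := dist_walk l1U ps2.
  apply/eqP; rewrite eq_le d1 /=.
  have := dist_triangle U x (last x s1) (last (last x s1) s2).
  rewrite -short; move: d1 d2.
  have := dist_ge0 U x (last x s1); have := dist_ge0 U (last x s1) (last (last x s1) s2).
  case: (dist _ _ x _) => [a| |] //; case: (dist _ _ _ _) => [b| |] //.
  rewrite -EFinD !lee_fin; lra.
suff main y' z' : (exists s1 s2 s3, [/\ s = s1 ++ s2 ++ s3, y' = last x s1 & z' = last y' s2]) ->
   [/\ (dist G U x y' < +oo)%E, (dist G U x z' < +oo)%E &
   (dist G U y' z' <= `|fine (dist G U x y') - fine (dist G U x z')|%:E)%E].
  case/splitPl Es : _ / => [p1 p2 l1]; rewrite -cat_cons mem_cat => /orP[].
  - case/splitPl Ep : _ / => [q1 q2 l2].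
    suff /main[? ? ?] : exists s1 s2 s3, [/\ s = s1 ++ s2 ++ s3, z = last x s1 & y = last z s2].
      by split=> //; rewrite dist_sym distrC.
    exists q1, q2, p2; split=> //; first by rewrite Es Ep catA.
    by rewrite -l2 -last_cat -Ep.
  - move=> zp2; apply: main; have : z \in y :: p2 by rewrite inE zp2 orbT.
    by case/splitPl Ep : _ / => [q1 q2 l2]; exists p1, q1, q2; rewrite Es Ep.
case=> s1 [s2 [s3 [es ey ez]]].
have e1 := pre _ _ es.
have e2 : dist G U x z' = (path_length G x (s1 ++ s2))%:E.
  by rewrite ez ey -last_cat; apply: (pre _ s3); rewrite -catA.
rewrite ey e1 e2 !ltry; split=> //=.
move: ps; rewrite es !cat_path => /and3P[ps1 ps2 _].
have yU : last x s1 \in U by apply: path_induced_all xU ps1 _ (mem_last _ _).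
rewrite ez ey; apply: le_trans (dist_walk yU ps2) _.
rewrite lee_fin path_length_cat; have := path_length_ge0 ps2 => l0.
rewrite opprD addrA subrr add0r normrN ger0_norm //.
Qed.

End Distances.
(** * Random carving *)

Section Carving.
Variables (R : realType) (V : finType).
Variables (F : R -> R) (r0 rmax : R).
(* [F x] is the probability that the random radius is at least [x]. *)
Hypothesis F_noninc : {homo F : x y / x <= y >-> y <= x}.
Hypothesis F_one : forall x, x <= r0 -> F x = 1.
Hypothesis F_zero : forall x, rmax <= x -> F x = 0.
Implicit Types (B A : {set V}) (f : V -> R) (As : seq {set V}).

Lemma F_ge0 x : 0 <= F x.
Proof.
have [h|/ltW h] := leP rmax x; first by rewrite F_zero.
by rewrite -(F_zero (lexx rmax)); exact: F_noninc.
Qed.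

Lemma F_le1 x : F x <= 1.
Proof.
have [h|/ltW h] := leP x r0; first by rewrite F_one.
by rewrite -(F_one (lexx r0)); exact: F_noninc.
Qed.

(** A discrete radius suffices for finitely many thresholds: each atom carries the drop of [F] up to
    the next threshold, the last one all the remaining mass. *)
Lemma sorted_threshold_law x xs : path <%R x xs ->
  exists w : seq (R * R), [/\ forall a, a \in w -> 0 <= a.1 /\ x <= a.2,
    \sum_(a <- w) a.1 = F x
    & forall y, y \in x :: xs -> \sum_(a <- w | y <= a.2) a.1 = F y].
Proof.
elim: xs x => [|z xs IH] x /=.
  move=> _; exists [:: (F x, x)]; split.
  - by move=> a; rewrite inE => /eqP->; split => //; exact: F_ge0.
  - by rewrite big_seq1.
  - by move=> y; rewrite inE => /eqP->; rewrite big_cons big_nil /= lexx addr0.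
case/andP=> xz zxs; have [w [w0 wsum wP]] := IH _ zxs.
exists ((F x - F z, x) :: w).
have tot : \sum_(a <- (F x - F z, x) :: w) a.1 = F x.
  by rewrite big_cons wsum subrK.
have ge a : a \in (F x - F z, x) :: w -> 0 <= a.1 /\ x <= a.2.
  rewrite inE => /predU1P[->|/w0[a0 za]] /=.
    by rewrite subr_ge0; split=> //; exact/F_noninc/ltW.
  by split=> //; apply: le_trans za; exact: ltW.
split=> // y; rewrite inE => /predU1P[->|yz].
  rewrite -[RHS]tot [LHS]big_seq_cond [RHS]big_seq; apply: eq_bigl => a.
  by case: (boolP (a \in _)) => // /ge[_ ->].
rewrite big_cons /= (_ : y <= x = false) ?wP //; apply/negbTE; rewrite -ltNge.
move: yz; rewrite inE => /predU1P[->//|yxs]; apply: lt_trans xz _.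
exact: (allP (order_path_min (@lt_trans _ _) zxs)).
Qed.

Lemma threshold_law (xs : seq R) :
  exists w : seq (R * R), [/\ forall a, a \in w -> 0 <= a.1,
    \sum_(a <- w) a.1 = 1
    & forall y, y \in xs -> \sum_(a <- w | y <= a.2) a.1 = F y].
Proof.
(* Including [r0] forces the least threshold to be at most [r0], where [F] is 1, so the total mass
   is 1. *)
pose ys := sort <=%R (undup (r0 :: xs)).
have memys y : (y \in ys) = (y \in r0 :: xs) by rewrite mem_sort mem_undup.
have : sorted <%R ys by rewrite sort_lt_sorted undup_uniq.
have r0ys : r0 \in ys by rewrite memys mem_head.
case: ys memys r0ys => [|x ys] // memys r0ys sys.
have xr0 : x <= r0.
  move: r0ys; rewrite inE => /predU1P[->//|r0ys].
  have := order_path_min (@lt_trans _ _) sys; move/allP/(_ _ r0ys); exact: ltW.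
have [w [w0 wsum wP]] := sorted_threshold_law sys.
exists w; split.
- by move=> a /w0[].
- by rewrite wsum F_one.
- by move=> y yxs; apply: wP; rewrite memys inE yxs orbT.
Qed.

(** The last clause keeps what matters about sublevel sets: the point of [B] with largest [f]
    decides whether [B] is swallowed, the one with least [f] whether [B] is touched. *)
Lemma carving_law f :
  exists w : seq (R * {set V}), [/\ forall a, a \in w -> 0 <= a.1,
    \sum_(a <- w) a.1 = 1,
    forall u, \sum_(a <- w | u \in a.2) a.1 = F (f u)
    & forall a, a \in w -> forall u v, f u <= f v -> v \in a.2 -> u \in a.2].
Proof.
have [w [w0 wsum wP]] := threshold_law [seq f u | u <- enum V].
exists [seq (a.1, [set u | f u <= a.2]) | a <- w]; split.
- by move=> _ /mapP[a /w0 ? ->].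
- by rewrite big_map.
- move=> u; rewrite big_map -wP; last by apply: map_f; rewrite mem_enum.
  by apply: eq_bigl => a; rewrite inE.
- by move=> _ /mapP[a _ ->] u v /= uv; rewrite !inE; exact: le_trans.
Qed.

(** The radius almost surely stays below [rmax], so every other centre misses [B]. *)
Definition relevant B f : bool := [exists u in B, f u < rmax].

Definition oscillation_le B (d : R) f : Prop := {in B &, forall u v, f u <= f v + d}.

(* A centre is represented by its distance function, and carves a random
   sublevel set of it.  [settled B d cs M]: some centre surely swallows [B], and
   among the earlier ones at most [M] can touch [B], on which their distance
   functions vary by at most [d]. *)
Inductive settled B (d : R) : seq (V -> R) -> nat -> Prop :=
| SettledNow f cs M of {in B, forall u, f u <= r0} : settled B d (f :: cs) M
| SettledSkip f cs M of ~~ relevant B f & settled B d cs M : settled B d (f :: cs) M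
| SettledPass f cs M of oscillation_le B d f & settled B d cs M :
    settled B d (f :: cs) M.+1.

(* Centres are indexed by [nth] because functions [V -> R] have no decidable equality. *)
Definition passable B d (cs : seq (V -> R)) (M : nat) : Prop :=
  (forall i, (i < size cs)%N -> relevant B (nth (fun=> 0) cs i) ->
     oscillation_le B d (nth (fun=> 0) cs i)) /\
  (count (relevant B) cs <= M)%N.

Lemma settled_weaken B d cs M N : (M <= N)%N -> settled B d cs M -> settled B d cs N.
Proof.
move=> MN st; elim: st N MN => {cs M} [f cs M h|f cs M h _ IH|f cs M h _ IH] N MN.
- exact: SettledNow.
- by apply: SettledSkip => //; exact: IH.
- by case: N MN => // N MN; apply: SettledPass => //; exact: IH.
Qed.

Lemma settled_prefix B d cs cs' M : settled B d cs M -> settled B d (cs ++ cs') M.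
Proof.
elim=> {cs M} [f cs M h|f cs M h _ IH|f cs M h _ IH] /=.
- exact: SettledNow.
- exact: SettledSkip.
- exact: SettledPass.
Qed.

Lemma passable_cons B d f cs M : passable B d (f :: cs) M ->
  if relevant B f then oscillation_le B d f /\ exists2 N, M = N.+1 & passable B d cs N
  else passable B d cs M.
Proof.
case=> osc /=; have oscf := osc 0%N isT.
have osc' i : (i < size cs)%N -> _ := osc i.+1.
case: ifP oscf => [rf /(_ isT) osf|rf _]; last by rewrite add0n.
by case: M => // M cM; split=> //; exists M.
Qed.

Lemma passable_nil B d M : passable B d [::] M.
Proof. by []. Qed.

Lemma passable_cat B d cs cs' M N : passable B d cs M -> passable B d cs' N ->
  passable B d (cs ++ cs') (M + N).
Proof.
case=> h1 c1 [h2 c2]; split=> [i|]; last by rewrite count_cat leq_add.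
rewrite size_cat nth_cat; case: (ltnP i (size cs)) => [ic _|ic ilt]; first exact: h1.
by apply: h2; rewrite ltn_subLR.
Qed.

Lemma settled_cat B d cs cs' M N : passable B d cs M -> settled B d cs' N ->
  settled B d (cs ++ cs') (M + N).
Proof.
move=> + st; elim: cs M => [|f cs IH] M.
  by move=> _; apply: settled_weaken st; exact: leq_addl.
move/passable_cons; case: ifP => [rf [ osf [M' -> pM']]|rf pM] /=.
  by apply: SettledPass => //; exact: IH.
by apply: SettledSkip; [rewrite rf|exact: IH].
Qed.

Lemma settled_nth B d cs i M : passable B d cs M -> (i < size cs)%N ->
  {in B, forall u, nth (fun=> 0) cs i u <= r0} -> settled B d cs M.
Proof.
elim: cs i M => [|f cs IH] [|i] M //= ps ilt cov; first exact: SettledNow.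
move/passable_cons: ps; case: ifP => [rf [ osf [M' -> pM']]|rf pM] /=.
  by apply: SettledPass => //; exact: IH cov.
by apply: SettledSkip; [rewrite rf|exact: IH cov].
Qed.

Lemma settled_covered B d cs M : settled B d cs M ->
  exists2 i, (i < size cs)%N & {in B, forall u, nth (fun=> 0) cs i u <= r0}.
Proof.
elim=> {cs M} [f cs M h|f cs M h _ [i ilt hi]|f cs M h _ [i ilt hi]].
- by exists 0%N.
- by exists i.+1.
- by exists i.+1.
Qed.

(** For nonempty [B]: the first set meeting [B] contains all of it, so [B] lands in one cluster. *)
Fixpoint captured B As : bool :=
  if As is A :: As' then
    (B \subset A) || ([disjoint B & A] && captured B As')
  else false.

Lemma captured_find B As u v : captured B As -> u \in B -> v \in B ->
  find (fun A : {set V} => u \in A) As = find (fun A : {set V} => v \in A) As.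
Proof.
move=> + uB vB; elim: As => [|A As IH] //= /orP[/fintype.subsetP BA|/andP[dis /IH->]].
  by rewrite !BA.
by rewrite !(disjointFr dis).
Qed.

(** The sets are drawn independently, and the law is built before [B] is fixed, so that one law
    serves all balls. Each centre passed costs at most (1 - q) kappa of the capture probability. *)
Lemma joint_carving_law (cs : seq (V -> R)) :
  exists W : seq (R * seq {set V}), [/\ forall w, w \in W -> 0 <= w.1,
    \sum_(w <- W) w.1 = 1,
    (forall w, w \in W -> w.1 != 0 -> size w.2 = size cs /\
       forall i u, (i < size cs)%N ->
        let x := nth (fun=> 0) cs i u in
        (x <= r0 -> u \in nth finset.set0 w.2 i) /\
        (u \in nth finset.set0 w.2 i -> x < rmax))
    & forall B (d q kappa : R) M, B != finset.set0 -> 0 <= q <= 1 -> 0 <= kappa ->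
        (forall x y, y <= x + d -> q * F x - (1 - q) * kappa <= F y) ->
        settled B d cs M ->
        q - (1 - q) * kappa * M%:R <= \sum_(w <- W | captured B w.2) w.1].
Proof.
elim: cs => [|f cs [W [W0 Wsum Wsupp WP]]].
  exists [:: (1, [::])]; split.
  - by move=> w; rewrite inE => /eqP->.
  - by rewrite big_seq1.
  - by move=> w; rewrite inE => /eqP->.
  - by move=> B d q k M _ _ _ _ st; inversion st.
have [w [w0 wsum wP wmono]] := carving_law f.
have wbig (P : pred _) : 0 <= \sum_(a <- w | P a) a.1.
  by rewrite big_seq_cond; apply: sumr_ge0 => a /andP[/w0].
have wzero (P : pred _) : \sum_(a <- w | P a) a.1 = 0 ->
    forall a, a \in w -> P a -> a.1 = 0.
  move=> /eqP; rewrite big_seq_cond psumr_eq0 => [/allP h a aw Pa|a /andP[/w0]//].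
  by have := h _ aw; rewrite aw Pa => /eqP.
exists [seq (a.1 * b.1, a.2 :: b.2) | a <- w, b <- W].
have sumE (P : pred _) : \sum_(c <- [seq (a.1 * b.1, a.2 :: b.2) | a <- w, b <- W] | P c.2) c.1 =
   \sum_(a <- w) a.1 * \sum_(b <- W | P (a.2 :: b.2)) b.1.
  rewrite big_mkcond big_allpairs_dep /=; apply: eq_bigr => a _.
  by rewrite -big_mkcond mulr_sumr.
split.
- by move=> _ /allpairsP[[a b] [/= /w0 a0 /W0 b0 ->]] /=; exact: mulr_ge0.
- rewrite (sumE xpredT) Wsum; under eq_bigr do rewrite mulr1; exact: wsum.
- move=> _ /allpairsP[[a b] [/= aw bW ->]] /=; rewrite mulf_eq0 negb_or => /andP[a0 b0].
  have [-> bP] := Wsupp _ bW b0; split=> // -[|i] u ilt /=; last exact: bP.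
  split=> [fr|ua].
    (* By [F_one] the sets containing [u] carry the whole mass, so a set missing [u] has weight
       0. *)
    apply/negPn/negP => una; move/eqP: a0; apply.
    apply: (wzero (fun a => u \notin a.2)) => //.
    have := wP u; rewrite F_one // => h.
    move: wsum; rewrite (bigID (fun a : R * {set V} => u \in a.2)) /= h.
    by rewrite -[RHS]addr0 => /addrI.
  rewrite ltNge; apply/negP => fr; move/eqP: a0; apply.
  by apply: (wzero (fun a => u \in a.2)) => //; rewrite wP F_zero.
move=> B d q k M B0 q01 k0 decay st; rewrite sumE.
have [u0 u0B] : exists u, u \in B by apply/set0Pn.
have [u1 u1B min1] := @Order.TotalTheory.arg_minP _ _ _ u0 (mem B) f u0B.
have [u2 u2B max2] := @Order.TotalTheory.arg_maxP _ _ _ u0 (mem B) f u0B.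
pose p := \sum_(b <- W | captured B b.2) b.1.
(* Condition on the first set: it swallows [B] iff it contains the farthest point [u2], and leaves
   [B] to the later sets iff it misses the nearest point [u1]. *)
have splitE : \sum_(a <- w) a.1 * (\sum_(b <- W | captured B (a.2 :: b.2)) b.1) =
    F (f u2) + (1 - F (f u1)) * p.
  have -> : 1 - F (f u1) = \sum_(a <- w | u1 \notin a.2) a.1.
    by rewrite -wsum (bigID (fun a : R * {set V} => u1 \in a.2)) /= wP addrAC subrr add0r.
  rewrite -wP mulr_suml [X in _ = X + _]big_mkcond [X in _ = _ + X]big_mkcond -big_split /=.
  apply: eq_big_seq => a aw.
  have sub : (B \subset a.2) = (u2 \in a.2).
    apply/fintype.subsetP/idP => [|h u uB]; first exact.
    exact: (wmono _ aw _ _ (max2 _ uB)).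
  have dis : [disjoint B & a.2] = (u1 \notin a.2).
    apply/idP/idP => [h|]; first by rewrite (disjointFr h).
    move=> h; apply/pred0P => u /=; apply/negbTE; apply: contra h => /andP[uB].
    exact: (wmono _ aw _ _ (min1 _ uB)).
  rewrite sub dis; case: ifP => u2a.
    rewrite Wsum mulr1 (wmono _ aw _ _ (min1 _ u2B) u2a) /= addr0 //.
  by case: ifP => _; rewrite /= add0r // big_pred0_eq mulr0.
rewrite splitE.
have p0 : 0 <= p by rewrite /p big_seq_cond; apply: sumr_ge0 => a /andP[/W0].
have F1 := F_le1 (f u1).
have F2 := F_ge0 (f u2).
have F10 := F_ge0 (f u1).
have k1 : 0 <= (1 - q) * k by apply: mulr_ge0 => //; lra.
have kM : 0 <= (1 - q) * k * M%:R by apply: mulr_ge0.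
move: (M) st kM => N st; inversion st as [? ? ? h|? ? ? h st'|? ? N' h st'] => kM.
- rewrite [F (f u2)]F_one; last exact: h.
  have : 0 <= (1 - F (f u1)) * p by apply: mulr_ge0 => //; lra.
  lra.
- have /F_zero-> : rmax <= f u1.
    rewrite leNgt; apply: contra h => h; apply/existsP; exists u1.
    exact/andP.
  have := WP _ _ _ _ _ B0 q01 k0 decay st'; rewrite -/p; lra.
(* The first set swallows [B] with probability at least q [F (f u1)] - (1 - q) kappa; the untouched
   mass 1 - [F (f u1)] succeeds later with probability at least q - (1 - q) kappa [N']. The main
   terms add up to q. *)
- have hp := WP _ _ _ _ _ B0 q01 k0 decay st'; rewrite -/p in hp.
  have := decay _ _ (h _ _ u2B u1B).
  have hm : (1 - F (f u1)) * (q - (1 - q) * k * N'%:R) <= (1 - F (f u1)) * p.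
    by apply: ler_wpM2l => //; lra.
  have N'0 : 0 <= F (f u1) * ((1 - q) * k * N'%:R) by rewrite mulr_ge0 // mulr_ge0.
  rewrite -natr1; lra.
Qed.

End Carving.
(** * Centres along the separators *)

Section Centres.
Variables (R : realType) (V : finType) (G : wgraph R V) (D : R).
Hypothesis D_gt0 : 0 < D.
Implicit Types (U H B : {set V}) (f : V -> R) (cs : seq (V -> R)).

Local Notation r0 := (27 / 100 * D).
Local Notation rmax := (D / 2).

Definition capped_dist H (t u : V) : R := fine (Order.min (dist G H t u) rmax%:E).

Lemma capped_distE H t u :
  (capped_dist H t u)%:E = Order.min (dist G H t u) rmax%:E.
Proof.
rewrite fineK //; have := dist_ge0 G H t u.
by case: (dist G H t u) => [a| |] // _; rewrite /Order.min; case: ifP.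
Qed.

Lemma capped_dist_le H t u a : (dist G H t u <= a%:E)%E -> capped_dist H t u <= a.
Proof. by move=> h; rewrite -lee_fin capped_distE ge_min h. Qed.

Lemma capped_dist_max H t u : capped_dist H t u <= rmax.
Proof. by rewrite -lee_fin capped_distE ge_min lexx orbT. Qed.

Lemma capped_dist_lt H t u : capped_dist H t u < rmax -> (dist G H t u < rmax%:E)%E.
Proof. by rewrite -lte_fin capped_distE gt_min ltxx orbF. Qed.

Lemma capped_dist_outside H t u : u \notin H -> capped_dist H t u = rmax.
Proof.
move=> uH; apply/eqP; rewrite eq_le capped_dist_max /= leNgt.
apply: contra uH => /capped_dist_lt h.
by have [] := dist_lt_mem (lt_trans h (ltry _)).
Qed.

Lemma dist_le_add H t u v (a b : R) : (dist G H t u <= a%:E)%E ->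
  (dist G H u v <= b%:E)%E -> (dist G H t v <= (a + b)%:E)%E.
Proof.
by move=> h1 h2; apply: le_trans (dist_triangle G H t u v) _; rewrite EFinD leeD.
Qed.

Lemma capped_dist_lip H t u v d : (dist G H u v <= d%:E)%E ->
  capped_dist H t u <= capped_dist H t v + d.
Proof.
move=> uvd; have d0 : 0 <= d by rewrite -lee_fin; apply: le_trans (dist_ge0 _ _ _ _) uvd.
have [h|h] := ltP (capped_dist H t v) rmax; last first.
  by apply: le_trans (capped_dist_max _ _ _) _; lra.
apply: capped_dist_le; apply: (@dist_le_add _ _ v); last by rewrite dist_sym.
by have := capped_dist_lt h; rewrite capped_distE le_min lexx => /ltW.
Qed.

(** The first clause keeps the centre from touching anything outside [H]; the second bounds the
    diameter of what it carves. *)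
Definition clustering_centre H f : Prop :=
  (forall u, u \notin H -> rmax <= f u) /\
  (forall u v, f u < rmax -> f v < rmax -> (dist G [set: V] u v <= D%:E)%E).

Definition clustering_centres H cs : Prop :=
  forall i, (i < size cs)%N -> clustering_centre H (nth (fun=> 0) cs i).

Lemma clustering_centres_cat H cs cs' :
  clustering_centres H cs -> clustering_centres H cs' -> clustering_centres H (cs ++ cs').
Proof.
move=> h1 h2 i; rewrite size_cat nth_cat; case: (ltnP i (size cs)) => [ic _|ic ilt].
  exact: h1.
by apply: h2; rewrite ltn_subLR.
Qed.

Lemma clustering_centres_sub H U cs : H \subset U ->
  clustering_centres H cs -> clustering_centres U cs.
Proof.
move=> /fintype.subsetP HU h i /h[h1 h2]; split=> // u uU; apply: h1.
by apply: contra uU; exact: HU.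
Qed.

Lemma capped_dist_clustering H t : clustering_centre H (capped_dist H t).
Proof.
split=> [u uH|u v /capped_dist_lt/ltW hu /capped_dist_lt/ltW hv].
  by rewrite capped_dist_outside.
apply: le_trans (dist_mono _ _ _ (finset.subsetT H)) _.
rewrite [X in X%:E](_ : D = rmax + rmax); last by lra.
by apply: (@dist_le_add _ _ t) => //; rewrite dist_sym.
Qed.

(** The distance is that of G[B] itself, so the bound passes by monotonicity to every residual graph
    containing [B]. *)
Definition small_ball B (rho : R) : Prop :=
  rho <= D / 100 /\
  exists2 v, v \in B & {in B, forall u, (dist G B v u <= rho%:E)%E}.

Lemma small_ball_dist B H rho : small_ball B rho -> B \subset H ->
  {in B &, forall u v, (dist G H u v <= (2 * rho)%:E)%E}.
Proof.
case=> _ [c cB hB] BH u v uB vB; rewrite [X in X%:E](_ : _ = rho + rho); last by lra.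
apply: le_trans (dist_mono _ _ _ BH) _; apply: (@dist_le_add _ _ c); last exact: hB.
by rewrite dist_sym hB.
Qed.

Lemma size_clustered_nats (s : seq nat) : uniq s ->
  {in s &, forall a b, (a <= b + 5)%N} -> (size s <= 6)%N.
Proof.
case: s => [//|x s] us close.
have [m ms mmin] : exists2 m, m \in x :: s & {in x :: s, forall a, (m <= a)%N}.
  have ex : exists m, m \in x :: s by exists x; rewrite mem_head.
  by case: (ex_minnP ex) => m ms mmin; exists m.
have : {subset x :: s <= iota m 6}.
  by move=> a ain; rewrite mem_iota mmin //= addnS ltnS close.
by move/(uniq_leq_size us); rewrite size_iota.
Qed.

(** Position on the path is distance from its first vertex; it is cut into cells of length D/4, and
    one vertex of each nonempty cell becomes a centre. *)
Lemma path_centres H q : shortest_path G H q ->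
  exists cs, clustering_centres H cs /\
  forall B rho, small_ball B rho -> B \subset H ->
    passable rmax B (2 * rho) cs 6 /\
    (forall x, x \in q -> x \in B -> exists2 i, (i < size cs)%N &
       {in B, forall u, nth (fun=> 0) cs i u <= r0}).
Proof.
case=> x0 [s [-> isp short]].
have close := shortest_path_dist isp short.
pose pos x := fine (dist G H x0 x).
pose bucket x := Num.truncn (pos x / (D / 4)).
have posE x : x \in x0 :: s -> dist G H x0 x = (pos x)%:E.
  by move=> xs; have [h _ _] := close _ _ xs xs; rewrite /pos fineK // dist_fin_numE.
have pos0 x : 0 <= pos x by rewrite /pos fine_ge0 // dist_ge0.
have bucketP x : (bucket x)%:R * (D / 4) <= pos x < (bucket x).+1%:R * (D / 4).
  rewrite -ler_pdivlMr ?divr_gt0 // -ltr_pdivrMr ?divr_gt0 //.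
  by apply: truncn_itv; rewrite divr_ge0 // ltW // divr_gt0.
pose bs := undup (map bucket (x0 :: s)).
pose rep b := nth x0 (x0 :: s) (find (fun t => bucket t == b) (x0 :: s)).
have repP b : b \in bs -> rep b \in x0 :: s /\ bucket (rep b) = b.
  rewrite mem_undup => /mapP[t ts ->].
  have hs : has (fun t' => bucket t' == bucket t) (x0 :: s) by apply/hasP; exists t.
  split; first by rewrite mem_nth // -has_find.
  exact/eqP/(nth_find x0 hs).
exists [seq capped_dist H (rep b) | b <- bs]; split.
  by move=> i; rewrite size_map => ilt; rewrite (nth_map 0%N) //; exact: capped_dist_clustering.
move=> B rho Bball BH; have Bd := small_ball_dist Bball BH.
have [rho_le [c cB hB]] := Bball.
split; first split.
- move=> i; rewrite size_map => ilt; rewrite (nth_map 0%N) // => _ u v uB vB.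
  exact/capped_dist_lip/Bd.
- rewrite count_map -size_filter; apply: size_clustered_nats.
    by rewrite filter_uniq // undup_uniq.
  suff near b : b \in seq.filter (preim (fun b => capped_dist H (rep b)) (relevant rmax B)) bs ->
      b \in bs /\ (dist G H (rep b) c <= (rmax + rho)%:E)%E.
    move=> a b /near[/repP[ra ba] da] /near[/repP[rb bb] db].
    (* Two centres touching [B] are within 2 (D/2 + D/100) = 1.02 D of each other, so their cell
       indices differ by at most 5 and there are at most 6 of them. *)
    have dab : (dist G H (rep b) (rep a) <= (rmax + rho + (rmax + rho))%:E)%E.
      by apply: dist_le_add db _; rewrite dist_sym.
    have : (dist G H x0 (rep a) <= (pos (rep b) + (rmax + rho + (rmax + rho)))%:E)%E.
      by apply: dist_le_add dab; rewrite posE.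
    rewrite posE // lee_fin => ple.
    have := bucketP (rep a); have := bucketP (rep b); rewrite ba bb => /andP[_ h1] /andP[h2 _].
    rewrite -ltnS -(ltr_nat R) -(ltr_pM2r (_ : 0 < D / 4)) ?divr_gt0 //.
    apply: le_lt_trans h2 _; apply: le_lt_trans ple _.
    move: h1; rewrite -[b.+1]addn1 -[(b + 5).+1]addn1 !natrD !mulrDl.
    by move: (b%:R * _) (pos _) => e y; have := D_gt0; lra.
  rewrite mem_filter => /andP[/existsP[u /andP[uB /capped_dist_lt/ltW du]] bbs].
  split=> //; apply: dist_le_add du _; rewrite dist_sym.
  by apply: le_trans (dist_mono _ _ _ BH) _; exact: hB.
move=> x xs xB; have bx : bucket x \in bs by rewrite mem_undup map_f.
exists (index (bucket x) bs); first by rewrite size_map index_mem.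
move=> u uB; rewrite (nth_map 0%N) ?index_mem // nth_index //.
have [rs rb] := repP _ bx.
have [_ _ dx] := close _ _ rs xs.
(* At most D/4 from the representative of the cell to [x], plus at most 2 D/100 inside [B]: this sum
   is the constant 27/100. *)
apply: capped_dist_le; apply: le_trans (dist_le_add dx (Bd _ _ xB uB)) _.
rewrite lee_fin -/(pos _) -/(pos _).
have : `|pos (rep (bucket x)) - pos x| <= D / 4.
  have := bucketP x; have := bucketP (rep (bucket x)); rewrite rb -[(bucket x).+1]addn1 natrD.
  by move=> /andP[? ?] /andP[? ?]; rewrite ler_norml; lra.
lra.
Qed.

Lemma group_centres H k X : union_of_shortest_paths G H k X ->
  exists cs, clustering_centres H cs /\
  forall B rho, small_ball B rho -> B \subset H ->
    passable rmax B (2 * rho) cs (6 * k) /\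
    (~~ [disjoint B & X] -> exists2 i, (i < size cs)%N &
       {in B, forall u, nth (fun=> 0) cs i u <= r0}).
Proof.
case=> Q [sQ ->].
elim: k Q sQ => [|k IH] Q sQ.
  exists [::]; split=> // B rho _ _; split; first exact: passable_nil.
  by rewrite big_ord0 disjoint_sym finset.disjoints_subset finset.sub0set.
have [cs [ccs csP]] := IH (fun i => Q (widen_ord (leqnSn k) i)) (fun i => sQ _).
have [cs' [ccs' csP']] := path_centres (sQ ord_max).
exists (cs ++ cs'); split; first exact: clustering_centres_cat.
move=> B rho Bb BH; have [p1 c1] := csP _ _ Bb BH; have [p2 c2] := csP' _ _ Bb BH.
split; first by rewrite mulnS addnC; exact: passable_cat.
rewrite big_ord_recr /= -finset.setI_eq0 finset.setIUr finset.setU_eq0 negb_and.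
case/orP=> [h|/set0Pn[x]].
  have /c1[i ilt hi] : ~~ [disjoint B & \bigcup_(i < k) [set x in Q (widen_ord (leqnSn k) i)]].
    by rewrite -finset.setI_eq0.
  by exists i; rewrite ?size_cat ?ltn_addr // nth_cat ilt.
rewrite !inE => /andP[xB xQ].
have [i ilt hi] := c2 _ xQ xB; exists (size cs + i)%N; first by rewrite size_cat ltn_add2l.
by rewrite nth_cat ltnNge leq_addr addKn.
Qed.

(** Induction on the number [n] of groups treated: either [B] is already settled, or it avoids the
    first [n] groups and so lies in the residual graph of the next one. *)
Lemma separator_centres U (m : nat) (P : 'I_m -> {set V}) (k : 'I_m -> nat) :
  (forall j : 'I_m, union_of_shortest_paths G
     (U :\: \bigcup_(i < m | (i < j)%N) P i) (k j) (P j)) ->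
  exists cs, clustering_centres U cs /\
  forall B rho, small_ball B rho -> B \subset U ->
    settled r0 rmax B (2 * rho) cs (6 * \sum_(j < m) k j) \/
    passable rmax B (2 * rho) cs (6 * \sum_(j < m) k j) /\
    [disjoint B & \bigcup_(j < m) P j].
Proof.
move=> usp.
suff : forall n, (n <= m)%N -> exists cs, clustering_centres U cs /\
  forall B rho, small_ball B rho -> B \subset U ->
    settled r0 rmax B (2 * rho) cs (6 * \sum_(j < m | (j < n)%N) k j) \/
    passable rmax B (2 * rho) cs (6 * \sum_(j < m | (j < n)%N) k j) /\
    [disjoint B & \bigcup_(j < m | (j < n)%N) P j].
  move=> /(_ m (leqnn m))[cs [ccs csP]]; exists cs; split=> // B rho Bb BU.
  have E : (fun j : 'I_m => (j < m)%N) =1 xpredT by move=> j; rewrite ltn_ord.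
  by have := csP _ _ Bb BU; rewrite !(eq_bigl _ _ E).
elim=> [|n IH] nm.
  exists [::]; split=> // B rho _ _; right; split; first exact: passable_nil.
  by rewrite big_pred0 // disjoint_sym finset.disjoints_subset finset.sub0set.
have [cs [ccs csP]] := IH (ltnW nm).
pose j0 := Ordinal nm.
have [cs' [ccs' csP']] := group_centres (usp j0).
have eqn (j : 'I_m) : ((j < n.+1) && (j != j0))%N = (j < n)%N.
  by rewrite -val_eqE /= ltnS; lia.
have sumS : (\sum_(j < m | (j < n.+1)%N) k j = \sum_(j < m | (j < n)%N) k j + k j0)%N.
  by rewrite (bigD1 j0) //= addnC; congr addn; apply: eq_bigl.
have cupS : \bigcup_(j < m | (j < n.+1)%N) P j = (\bigcup_(j < m | (j < n)%N) P j) :|: P j0.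
  by rewrite (bigD1 j0) //= finset.setUC; congr finset.setU; apply: eq_bigl.
exists (cs ++ cs'); split.
  by apply: clustering_centres_cat => //; apply: clustering_centres_sub ccs'; exact: subsetDl.
move=> B rho Bb BU; rewrite sumS cupS mulnDr.
have [st|[ps dis]] := csP _ _ Bb BU.
  by left; apply/settled_prefix/(settled_weaken _ st)/leq_addr.
have BH : B \subset U :\: \bigcup_(i < m | (i < j0)%N) P i by rewrite finset.subsetD BU.
have [ps' cov] := csP' _ _ Bb BH.
have [dis'|ndis] := boolP [disjoint B & P j0]; last first.
  left; apply: settled_cat => //; have [i ilt hi] := cov ndis.
  exact: settled_nth ilt hi.
right; split; first exact: passable_cat.
by rewrite -finset.setI_eq0 finset.setIUr finset.setU_eq0 !finset.setI_eq0 dis dis'.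
Qed.

End Centres.

(** * Recursion through the flaps *)

Section Recursion.
Variables (R : realType) (V : finType) (G : wgraph R V) (D : R).
Hypothesis D_gt0 : 0 < D.
Implicit Types (U F B S : {set V}) (cs : seq (V -> R)).

Local Notation r0 := (27 / 100 * D).
Local Notation rmax := (D / 2).

Lemma connect_equivalence U : {in U & &, equivalence_rel (connect (induced G U))}.
Proof.
move=> x y z _ _ _; split=> [|xy]; first exact: connect0.
have sym := sym_connect_sym (induced_sym G U).
exact: same_connect sym _ _ xy z.
Qed.

Lemma flaps_partition U S : finset.partition (flaps G U S) (U :\: S).
Proof. exact/equivalence_partitionP/connect_equivalence. Qed.

(** All of [B] is joined to its centre inside [B], so a ball avoiding [S] falls in a single
    component. *)
Lemma small_ball_flap U S B rho : small_ball G D B rho -> B \subset U :\: S ->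
  exists F, [/\ F \in flaps G U S, B \subset F & (0 < #|F|)%N].
Proof.
case=> _ [v vB hB] BUS; have vUS := fintype.subsetP BUS _ vB.
have vcov : v \in finset.cover (flaps G U S).
  by rewrite (finset.cover_partition (flaps_partition U S)).
exists (finset.pblock (flaps G U S) v); split; first exact: finset.pblock_mem.
- apply/fintype.subsetP => u uB.
  rewrite finset.pblock_equivalence_partition //; first 1 last.
  + exact: connect_equivalence.
  + exact: (fintype.subsetP BUS).
  apply: dist_connect; apply: le_lt_trans (dist_mono _ _ _ BUS) _.
  exact: le_lt_trans (hB _ uB) (ltry _).
- by apply/card_gt0P; exists v; rewrite finset.mem_pblock.
Qed.

(** The bound does not grow with the number of members: centres of a member disjoint from the one
    containing [B] cannot touch [B] and are skipped for free. *)
Lemma family_centres U (L : seq {set V}) (M : nat) :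
  {in L &, forall F F', F != F' -> [disjoint F & F']} ->
  (forall F, F \in L -> F \subset U /\ exists cs, clustering_centres G D F cs /\
     forall B rho, small_ball G D B rho -> B \subset F ->
       settled r0 rmax B (2 * rho) cs M) ->
  exists cs, clustering_centres G D U cs /\
  forall B rho F, small_ball G D B rho -> F \in L -> B \subset F ->
    settled r0 rmax B (2 * rho) cs M.
Proof.
elim: L => [|F L IH] dis hL; first by exists [::].
have [||cs [ccs csP]] := IH.
- by move=> F1 F2 h1 h2; apply: dis; rewrite inE ?h1 ?h2 orbT.
- by move=> F1 h1; apply: hL; rewrite inE h1 orbT.
have [FU [cs' [ccs' csP']]] := hL F (mem_head _ _).
exists (cs' ++ cs); split.
  by apply: clustering_centres_cat => //; exact: clustering_centres_sub ccs'.
move=> B rho F1 Bb; rewrite inE => F1L BF1.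
have [e|ne] := eqVneq F1 F.
  by apply/settled_prefix/csP' => //; rewrite -e.
rewrite (negbTE ne) /= in F1L.
rewrite -[M]add0n; apply: settled_cat; last exact: csP BF1.
have skip i : (i < size cs')%N -> ~~ relevant rmax B (nth (fun=> 0) cs' i).
  move=> /ccs'[out _]; apply/negP => /existsP[u /andP[uB]]; apply/negP; rewrite -leNgt.
  apply: out; have dFF : [disjoint F1 & F] by apply: dis; rewrite // inE ?F1L ?eqxx ?orbT.
  by rewrite (disjointFr dFF) //; exact: (fintype.subsetP BF1).
split=> [i /skip/negP//|].
rewrite leqn0 eqn0Ngt -has_count; apply/(has_nthP (fun=> 0)) => -[i /skip/negP].
exact.
Qed.

(** Each level of the recursion adds at most 6 p touching centres, and balance at least halves the
    vertex set at each level, whence the logarithm. *)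
Lemma separable_centres p U : path_separable G p U ->
  exists cs, clustering_centres G D U cs /\
  forall B rho, small_ball G D B rho -> B \subset U ->
    settled r0 rmax B (2 * rho) cs (6 * p * (trunc_log 2 #|U|).+1).
Proof.
elim=> {}U S m P k SU SE usp kp bal _ IH.
have [cs [ccs csP]] := separator_centres D_gt0 usp.
have part := flaps_partition U S.
pose M := (6 * p * trunc_log 2 #|U|)%N.
have [||cs' [ccs' csP']] := @family_centres U (enum (flaps G U S)) M.
- move=> F F'; rewrite !mem_enum => h h'.
  by have [_ /finset.trivIsetP tr _] := and3P part; exact: tr.
- move=> F; rewrite mem_enum => hF; split.
    apply: fintype.subset_trans (finset.subsetDl U S).
    by rewrite -(finset.cover_partition part); exact: finset.bigcup_sup.
  have [csF [ccsF csFP]] := IH _ hF; exists csF; split=> // B rho Bb BF.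
  apply: settled_weaken (csFP _ _ Bb BF); rewrite leq_mul2l; apply/orP; right.
  (* The identity log2 (2 |F|) = log2 |F| + 1 for [trunc_log] fails at |F| = 0; the centre of [B]
     excludes that case. *)
  have F0 : (0 < #|F|)%N.
    by case: Bb => _ [v vB _]; apply/card_gt0P; exists v; exact: (fintype.subsetP BF).
  by rewrite -trunc_logMp //; apply: leq_trunc_log; exact: bal.
exists (cs ++ cs'); split; first exact: clustering_centres_cat.
move=> B rho Bb BU; rewrite mulnS -/M.
have le6 : (6 * \sum_(j < m) k j <= 6 * p)%N by rewrite leq_mul2l kp.
have [st|[[ps cps] dis]] := csP _ _ Bb BU.
  apply/settled_prefix/(settled_weaken _ st)/(leq_trans le6)/leq_addr.
apply: settled_cat; first by split=> //; exact: leq_trans le6.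
have [|F [hF BF _]] := small_ball_flap Bb (_ : B \subset U :\: S).
  by rewrite finset.subsetD BU SE.
by apply: csP' BF; rewrite // mem_enum.
Qed.

End Recursion.

(** * The truncated exponential law *)

Section Survival.
Variables (R : realType) (l L r0 : R).
Hypotheses (l_gt0 : 0 < l) (L_gt0 : 0 < L).

(** Cutting the exponential law of rate [l] off at length L / l and renormalizing gives the tail
    (e^(-l(x - r0)) - e^(-L)) / (1 - e^(-L)), which is [survival_exp] with this constant. *)
Definition survival_defect : R := (expR L - 1)^-1.
Local Notation kappa := survival_defect.
Definition survival_exp (x : R) : R := (1 + kappa) * expR (- (l * (x - r0))) - kappa.
Definition survival (x : R) : R := Num.max 0 (Num.min 1 (survival_exp x)).

Lemma survival_defect_gt0 : 0 < kappa.
Proof. by rewrite invr_gt0 subr_gt0 expR_gt1. Qed.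

Lemma survival_exp_noninc x y : x <= y -> survival_exp y <= survival_exp x.
Proof.
move=> xy; have k0 := survival_defect_gt0; rewrite /survival_exp lerD2r.
rewrite ler_pM2l ?addr_gt0 // ler_expR lerN2; apply: ler_wpM2l; [exact: ltW|lra].
Qed.

Lemma survival_noninc x y : x <= y -> survival y <= survival x.
Proof.
move=> /survival_exp_noninc h; rewrite /survival.
by rewrite ge_max !le_max lexx /= le_min !ge_min lexx h /= !orbT.
Qed.

Lemma survival_one x : x <= r0 -> survival x = 1.
Proof.
move=> xr0; rewrite /survival.
suff h : 1 <= survival_exp x by rewrite (min_idPl h) (max_idPr ler01).
have k0 := survival_defect_gt0.
apply: le_trans (survival_exp_noninc xr0).
by rewrite /survival_exp subrr mulr0 oppr0 expR0 mulr1 addrK.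
Qed.

Lemma survival_zero x : r0 + L / l <= x -> survival x = 0.
Proof.
move=> hx; rewrite /survival; apply: max_idPl; rewrite ge_min; apply/orP; right.
apply: le_trans (survival_exp_noninc hx) _.
rewrite /survival_exp addrAC subrr add0r [l * _]mulrC divfK ?gt_eqF // subr_le0.
have e1 : 0 < expR L - 1 by rewrite subr_gt0 expR_gt1.
rewrite expRN ler_pdivrMr ?expR_gt0 // /survival_defect.
rewrite -[X in X + _](divff (lt0r_neq0 e1)) -{2}[(_ - 1)^-1]mul1r -mulrDl subrK mulrC //.
Qed.

(** Memorylessness: a shift by [d] multiplies [survival_exp] + kappa exactly by q = e^(-l d), which
    leaves the additive defect (1 - q) kappa. *)
Lemma survival_decay d x y : 0 <= d -> y <= x + d ->
  expR (- (l * d)) * survival x - (1 - expR (- (l * d))) * kappa <= survival y.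
Proof.
move=> d0 yx; set q := expR _.
have q0 : 0 < q by exact: expR_gt0.
have q1 : q <= 1 by rewrite -expR0 ler_expR oppr_le0; apply: mulr_ge0 => //; exact: ltW.
have k0 := survival_defect_gt0.
have key : q * survival_exp x - (1 - q) * kappa <= survival_exp y.
  apply: le_trans (survival_exp_noninc yx).
  rewrite /survival_exp (_ : - (l * (x + d - r0)) = - (l * (x - r0)) + - (l * d)); last by ring.
  by rewrite expRD -/q; lra.
have kq : 0 <= (1 - q) * kappa by apply: mulr_ge0; [lra | exact: ltW].
(* If the unclamped tail at [x] is at most 0, so is the left side; otherwise the clamped value is
   below both 1 and the unclamped tail, and each bounds one argument of the minimum. *)
rewrite {2}/survival; rewrite le_max; have [gx|gx] := leP (survival_exp x) 0.
  apply/orP; left; rewrite /survival.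
  rewrite (_ : Num.max _ _ = 0) ?mulr0; first by lra.
  by apply: max_idPl; rewrite ge_min gx orbT.
apply/orP; right; rewrite le_min.
have sx1 : survival x <= 1 by rewrite /survival ge_max ler01 ge_min lexx.
have sxe : survival x <= survival_exp x.
  by rewrite /survival ge_max (ltW gx) ge_min lexx orbT.
have h1 := ler_wpM2l (ltW q0) sx1; have h2 := ler_wpM2l (ltW q0) sxe.
apply/andP; split; lra.
Qed.

End Survival.
(** * The random partition *)

Section Decomposition.
Variables (R : realType) (V : finType) (G : wgraph R V).

(** Vertices are classed by the index of the first set containing them; those in no set would share
    the label [size As]. *)
Definition carved_partition (As : seq {set V}) : {set {set V}} :=
  preim_partition (fun v => find (fun A : {set V} => v \in A) As) [set: V].

Lemma mem_carved_pblock As u v : (v \in finset.pblock (carved_partition As) u) =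
  (find (fun A : {set V} => u \in A) As == find (fun A : {set V} => v \in A) As).
Proof.
rewrite /carved_partition /preim_partition.
rewrite finset.pblock_equivalence_partition ?inE // => x y z _ _ _.
by split=> // /eqP->.
Qed.

Lemma ball_set_small D v rho : rho <= D / 100 -> 0 <= rho ->
  small_ball G D (ball_set G v rho) rho.
Proof.
move=> rD rho0; split=> //; exists v; first by rewrite inE dist_refl ?inE.
by move=> u; rewrite inE; exact: ball_set_inner.
Qed.

Lemma carving_decomposition (D l L : R) cs M : 0 < D -> 0 < l -> 0 < L ->
  27 / 100 * D + L / l = D / 2 ->
  clustering_centres G D [set: V] cs ->
  (forall B rho, small_ball G D B rho ->
     settled (27 / 100 * D) (D / 2) B (2 * rho) cs M) ->
  exists mu : {ffun {set {set V}} -> R},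
    [/\ partition_distribution mu,
        forall Pi, mu Pi != 0 -> forall S, S \in Pi -> (diam G S <= D%:E)%E
      & forall (x : V) (gamma : R), 0 <= gamma <= 1 / 100 ->
          let q := expR (- (l * (2 * (gamma * D)))) in
          q - (1 - q) * survival_defect L * M%:R <=
          prob mu (fun Pi => ball_set G x (gamma * D) \subset finset.pblock Pi x)].
Proof.
move=> D0 l0 L0 rE ccs csP; set r0 := 27 / 100 * D in rE csP.
have zero x : D / 2 <= x -> survival l L r0 x = 0.
  by rewrite -rE; exact: survival_zero.
have [W [W0 Wsum Wsupp WP]] := joint_carving_law
  (survival_noninc r0 l0 L0) (survival_one l0 L0 (r0 := r0)) zero cs.
pose mu : {ffun {set {set V}} -> R} :=
  [ffun Pi => \sum_(w <- W | carved_partition w.2 == Pi) w.1].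
have muE (A : pred {set {set V}}) :
    \sum_(Pi | A Pi) mu Pi = \sum_(w <- W | A (carved_partition w.2)) w.1.
  under eq_bigr do rewrite ffunE.
  rewrite (exchange_big_dep (fun w => A (carved_partition w.2))) /=; last first.
    by move=> Pi w APi /eqP->.
  apply: eq_bigr => w Aw; rewrite (big_pred1 (carved_partition w.2)) // => Pi /=.
  by rewrite eq_sym; case: eqP => [->|_]; rewrite ?Aw ?andbF.
have supp Pi : mu Pi != 0 -> exists2 w, w \in W & w.1 != 0 /\ Pi = carved_partition w.2.
  rewrite ffunE => nz; apply: contrapT => none; move/eqP: nz; apply.
  rewrite big_seq_cond big1 // => w /andP[wW /eqP wPi]; apply: contrapT => /eqP w0.
  by apply: none; exists w.
exists mu; split.
- split.
  + by move=> Pi; rewrite ffunE big_seq_cond; apply: sumr_ge0 => w /andP[/W0].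
  + by rewrite muE.
  + by move=> Pi /supp[w _ [_ ->]]; exact: preim_partitionP.
- move=> Pi /supp[w wW [w0 ->]] S SPi.
  have [sz wP] := Wsupp _ wW w0.
  suff duv u v : u \in S -> v \in S -> (dist G [set: V] u v <= D%:E)%E.
    have D0' : (0 <= D%:E)%E by rewrite lee_fin ltW.
    apply: bigmax_le => // u uS; apply: bigmax_le => // v vS; exact: duv.
  move=> uS vS.
  have /eqP same : find (fun A : {set V} => u \in A) w.2 == find (fun A : {set V} => v \in A) w.2.
    rewrite -mem_carved_pblock (finset.def_pblock _ SPi uS) //.
    by have /and3P[] := preim_partitionP (fun v => find (fun A : {set V} => v \in A) w.2) [set: V].
  (* The ball of radius 0 around [x] is settled, so some centre has value at most [r0] at [x], and
     its set contains [x] in every outcome of nonzero mass. *)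
  have covered x : (find (fun A : {set V} => x \in A) w.2 < size cs)%N.
    have Bx := @ball_set_small D x 0 (divr_ge0 (ltW D0) (ler0n _ _)) (lexx _).
    have [i ilt hi] := settled_covered (csP _ _ Bx).
    rewrite -sz -has_find; apply/(has_nthP finset.set0); exists i; first by rewrite sz.
    apply: (wP i x ilt).1; apply: hi.
    by rewrite inE dist_refl ?inE.
  have inA x : x \in nth finset.set0 w.2 (find (fun A : {set V} => x \in A) w.2).
    by apply: (nth_find finset.set0 (a := fun A : {set V} => x \in A)); rewrite has_find sz.
  (* Both points lie in the set carved by one and the same centre, so its values there are below
     [rmax]. *)
  have [_ clus] := ccs _ (covered u).
  apply: clus; apply: (wP _ _ (covered u)).2; first exact: inA.
  by rewrite same; exact: inA.
- move=> x gamma /andP[g0 g1]; set q := expR _ => /=.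
  have rho0 : 0 <= gamma * D by apply: mulr_ge0 => //; exact: ltW.
  have rhoD : gamma * D <= D / 100.
    by rewrite mulrC; apply: ler_wpM2l; [exact: ltW | lra].
  have Bx := ball_set_small x rhoD rho0.
  have xB : x \in ball_set G x (gamma * D) by rewrite inE dist_refl ?inE.
  have d0 : 0 <= 2 * (gamma * D) by apply: mulr_ge0.
  have q01 : 0 <= q <= 1.
    by rewrite expR_ge0 -expR0 ler_expR oppr_le0 mulr_ge0 // ltW.
  have B0 : ball_set G x (gamma * D) != finset.set0 by apply/set0Pn; exists x.
  have := WP _ _ q _ M B0 q01 (ltW (survival_defect_gt0 L0))
    (fun _ _ => survival_decay r0 l0 L0 d0) (csP _ _ Bx).
  move/le_trans; apply; rewrite /prob muE.
  rewrite [leLHS]big_mkcond [leRHS]big_mkcond [leLHS]big_seq [leRHS]big_seq.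
  apply: ler_sum => w wW; case: ifP => [cap|_]; last by case: ifP => // _; exact: W0.
  rewrite ifT //; apply/fintype.subsetP => u uB; rewrite mem_carved_pblock.
  exact/eqP/(captured_find cap).
Qed.

End Decomposition.

(** * Numerical estimates *)

Section Constants.
Variable R : realType.

Lemma ln2_ge_half : 1 / 2 <= ln 2 :> R.
Proof.
have h : ln (1 + - (1 / 2)) <= - (1 / 2) :> R by apply: le_ln1Dx; lra.
move: h; rewrite (_ : 1 + - (1 / 2) = 2^-1 :> R); last by lra.
by rewrite lnV ?posrE //; lra.
Qed.

(** As ln 2 >= 1/2, both the truncated log2 n and 1 are at most 2 ln n. *)
Lemma trunc_log2_le (n : nat) : (2 <= n)%N ->
  (trunc_log 2 n).+1%:R <= 4 * ln n%:R :> R.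
Proof.
move=> n2; have l2 := ln2_ge_half; have n0 : 0 < n%:R :> R by rewrite ltr0n; lia.
have n1 : ln 2 <= ln n%:R :> R by rewrite ler_ln ?posrE // ler_nat.
have : ln (2 ^+ trunc_log 2 n) <= ln n%:R :> R.
  rewrite ler_ln ?posrE ?exprn_gt0 // -natrX ler_nat.
  by apply: trunc_logP => //; lia.
rewrite lnXn // -[ln 2 *+ _]mulr_natr => h.
have : (trunc_log 2 n)%:R / 2 <= ln 2 * (trunc_log 2 n)%:R :> R.
  by rewrite mulrC; apply: ler_wpM2r; rewrite ?ler0n //; lra.
rewrite -[(trunc_log 2 n).+1]addn1 natrD; lra.
Qed.

(* [6 p (log2 n + 1)] is at most [24 e^mu]; the exponent 23 leaves ample room. *)
Lemma defect_bound (p n : nat) (mu : R) : (2 <= n)%N ->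
  1 <= mu -> ln (p%:R * ln n%:R) <= mu ->
  survival_defect (23 * mu) * (6 * p * (trunc_log 2 n).+1)%:R <= expR (- (2 * mu)).
Proof.
move=> n2 mu1 lnmu; have l2 := ln2_ge_half.
have n1 : 0 < ln n%:R :> R by apply: ln_gt0; rewrite ltr1n.
have E2 : 2 <= expR mu by apply: le_trans (expR_ge1Dx mu); lra.
have E0 := expR_gt0 mu.
have pn : p%:R * ln n%:R <= expR mu.
  (* For p = 0 the logarithm in [lnmu] is only a default value, so the bound is checked directly. *)
  have [->|p0] := posnP p; first by rewrite mul0r ltW.
  by rewrite -[leLHS]lnK ?ler_expR // posrE mulr_gt0 // ltr0n.
have M24 : (6 * p * (trunc_log 2 n).+1)%:R <= 24 * expR mu :> R.
  rewrite !natrM -mulrA; have := ler_wpM2l (ler0n R p) (trunc_log2_le n2); lra.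
(* Since e^(20 mu) >= 2^5 > 25, the denominator e^(23 mu) - 1 is at least 24 e^(3 mu), which absorbs
   24 e^mu times e^(2 mu). *)
have e23 : expR (23 * mu) = expR mu ^+ 3 * expR mu ^+ 20.
  by rewrite -exprD -expRM_natl.
have e20 : 25 <= expR mu ^+ 20.
  have h5 : 2 ^+ 5 <= expR mu ^+ 5 by rewrite lerXn2r ?nnegrE // ltW.
  have : expR mu ^+ 5 <= expR mu ^+ 20 by apply: ler_weXn2l => //; lra.
  move: h5; lra.
have e3 : 1 <= expR mu ^+ 3 by apply: exprn_ege1; lra.
have den : 24 * expR mu ^+ 3 <= expR (23 * mu) - 1.
  rewrite e23; have := ler_wpM2l (le_trans ler01 e3) e20; lra.
have den0 : 0 < expR (23 * mu) - 1 by apply: lt_le_trans den; lra.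
rewrite /survival_defect mulrC ler_pdivrMr // mulrC expRN ler_pdivlMr ?expR_gt0 //.
apply: le_trans den; rewrite (expRM_natl 2).
apply: le_trans (ler_wpM2r (exprn_ge0 2 (ltW E0)) M24) _.
by rewrite -mulrA -exprS.
Qed.

(** From gamma <= 1/100 follows e^(-2 mu) <= q, so the right side is at least q - (1 - q) q = q^2 =
    e^(-400 mu gamma); as ln 2 >= 1/2, base 2 needs at most the exponent 800 mu gamma. *)
Lemma capture_bound (mu gamma delta : R) (M : nat) : 1 <= mu -> 0 <= gamma <= 1 / 100 ->
  delta * M%:R <= expR (- (2 * mu)) ->
  let q := expR (- (200 * mu * gamma)) in
  2 `^ (- (800 * mu * gamma)) <= q - (1 - q) * delta * M%:R.
Proof.
move=> mu1 /andP[g0 g1] dM /=; set q := expR _; have l2 := ln2_ge_half.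
have mg : 0 <= mu * gamma by apply: mulr_ge0 => //; lra.
have mg1 : mu * gamma <= mu * (1 / 100) by apply: ler_wpM2l => //; lra.
have q1 : q <= 1 by rewrite -expR0 ler_expR; lra.
have dq : delta * M%:R <= q by apply: le_trans dM _; rewrite ler_expR; lra.
have : q * q <= q - (1 - q) * delta * M%:R.
  have : (1 - q) * (delta * M%:R) <= (1 - q) * q by apply: ler_wpM2l => //; lra.
  lra.
apply: le_trans; rewrite /q -expRD /powR (_ : 2 == 0 = false) ?pnatr_eq0 // ler_expR.
have : mu * gamma * (1 / 2) <= mu * gamma * ln 2 by apply: ler_wpM2l.
lra.
Qed.

End Constants.

(** * Choice of the parameters *)

Theorem theorem1 (R : realType) :
  exists C : R, 0 < C /\
  forall (p : nat) (V : finType) (G : wgraph R V),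
    connected_graph G -> path_separable G p [set: V] -> (2 <= #|V|)%N ->
    decomposable G (C * Num.max 1 (ln (p%:R * ln #|V|%:R))).
Proof.
exists 800; split; first by rewrite ltr0n.
move=> p V G _ sep V2.
set mu := Num.max _ _.
have mu1 : 1 <= mu by rewrite le_max lexx.
have lnmu : ln (p%:R * ln #|V|%:R) <= mu by rewrite le_max lexx orbT.
split; first by lra.
move=> D D0.
have [cs [ccs csP]] := separable_centres D0 sep.
(* Rate 100 mu / D and L = 23 mu make the window L / l equal to 0.23 D, exactly the gap between 0.27
   D and D/2. *)
have l0 : 0 < 100 * mu / D by apply: divr_gt0 => //; lra.
have L0 : 0 < 23 * mu by lra.
have rE : 27 / 100 * D + 23 * mu / (100 * mu / D) = D / 2.
  by field; rewrite !gt_eqF //; lra.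
have [nu [nu1 nu2 nu3]] := carving_decomposition D0 l0 L0 rE ccs
  (fun B rho Bb => csP B rho Bb (finset.subsetT B)).
exists nu; split=> // x gamma g01.
apply: le_trans (nu3 x gamma g01).
have -> : 100 * mu / D * (2 * (gamma * D)) = 200 * mu * gamma.
  by field; rewrite gt_eqF.
by apply: capture_bound => //; rewrite cardsT; exact: defect_bound.
Qed.
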